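(* Consider the online convex optimization setting with stochastic gradients described in the context, and run Algorithm 1 with $N=\frac{\beta D}{\sigma}\sqrt{T}$ (assumed to be a positive integer), so that it makes $N$ stochastic gradient oracle calls per round and no projections. Suppose each of the $N$ online linear optimizers is instantiated with an online linear optimizer (e.g. Follow the Perturbed Leader) whose expected regret on linear losses $x\mapsto g^\top x$ with $\|g\|\le\sigma$ over $\mathcal K$ is $O(\sigma D\sqrt T)$. Then for any sequence of convex losses $\ell_1,\dots,\ell_T\in\mathcal L$ and any $x^*\in\mathcal K$, \[ \mathbb{E}\Big[\sum_{t=1}^T \ell_t(x_t)-\sum_{t=1}^T \ell_t(x^* )\Big]\le O\big(\sigma D\sqrt T\big), \] where the expectation is over the oracle's randomness and the internal randomness of the online linear optimizers, and $O(\cdot)$ hides absolute constants.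
   Context: Let $\mathcal K\subset\mathbb R^d$ be a compact convex set of diameter $D$ (i.e. $\|x-x'\|\le D$ for all $x,x'\in\mathcal K$). A class $\mathcal L$ of convex functions on $\mathcal K$ is given; the losses $\ell_1,\dots,\ell_T\in\mathcal L$ are fixed in advance (oblivious adversary). Assumptions: (A1) every $\ell\in\mathcal L$ is $\beta$-smooth: $\|\nabla\ell(x)-\nabla\ell(x')\|\le\beta\|x-x'\|$ for all $x,x'\in\mathcal K$; (A2) a stochastic gradient oracle $\mathcal O$, queried at round $t$ at a point $x\in\mathcal K$, returns a random vector $\mathbf g$ (using fresh randomness) with $\mathbb E[\mathbf g]=\nabla\ell_t(x)$ and $\|\mathbf g\|^2\le\sigma^2$. An online linear optimizer (OLO) over $\mathcal K$ is an online algorithm which at each round outputs a point of $\mathcal K$ based on the linear losses $\ell'_s(x)=g_s^\top x$ ($\|g_s\|\le\sigma$) revealed in previous rounds; its regret is $\sum_{t}\ell'_t(x_t)-\min_{x\in\mathcal K}\sum_t\ell'_t(x)$. Algorithm 1: maintain $N$ OLOs $\mathcal A_1,\dots,\mathcal A_N$ and step sizes $\eta_i=\frac{2}{i+1}$. At each round $t=1,\dots,T$: set $\mathbf x_t^0=\mathbf 0$; for $i=1,\dots,N$: let $x_{t,i}\in\mathcal K$ be the output of $\mathcal A_i$ at round $t$ (having seen $\ell^i_1,\dots,\ell^i_{t-1}$), set $\mathbf x_t^i=(1-\eta_i)\mathbf x_t^{i-1}+\eta_i x_{t,i}$, query the oracle at $\mathbf x_t^{i-1}$ to get $\mathbf g_{t,i}$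 with $\mathbb E[\mathbf g_{t,i}]=\nabla\ell_t(\mathbf x_t^{i-1})$, and pass the linear loss $\ell_t^i(x)=\mathbf g_{t,i}^\top x$ to $\mathcal A_i$. The prediction is $x_t=\mathbf x_t^N$, and the loss $\ell_t(x_t)$ is incurred. *)

(* Defs.v *)
From HB Require Import structures.
From mathcomp Require Import all_boot all_order all_algebra.
From mathcomp Require Import all_classical all_reals all_analysis.
Set Implicit Arguments. Unset Strict Implicit. Unset Printing Implicit Defensive.
Import Order.TTheory GRing.Theory Num.Theory.
Import numFieldNormedType.Exports.
Local Open Scope classical_set_scope.
Local Open Scope ring_scope.

Section Defs.
Variables (R : realType) (d : nat).
Local Notation V := 'rV[R]_d.

Definition dotv (u v : V) : R := \sum_(j < d) u 0 j * v 0 j.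
Definition enorm (u : V) : R := Num.sqrt (dotv u u).

Definition grad (f : V -> R) (x : V) : V :=
  \row_(j < d) 'D_(delta_mx 0 j) f x.

Definition convex_fun_on (K : set V) (f : V -> R) : Prop :=
  forall x y (a : R), K x -> K y -> 0 <= a <= 1 ->
    f (a *: x + (1 - a) *: y) <= a * f x + (1 - a) * f y.

Definition smooth_on (K : set V) (beta : R) (f : V -> R) : Prop :=
  (forall x, K x -> differentiable f x) /\
  (forall x y, K x -> K y -> enorm (grad f x - grad f y) <= beta * enorm (x - y)).

Definition eta (i : nat) : R := 2 / (i.+1)%:R.

(* x^0 = 0, x^i = (1 - eta_i) x^{i-1} + eta_i x_{t,i};  X i = x_{t,i} *)
Fixpoint fw_iter (X : nat -> V) (i : nat) : V :=
  match i with
  | 0 => 0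
  | k.+1 => (1 - eta k.+1) *: fw_iter X k + eta k.+1 *: X k.+1
  end.

Definition olo_regret (K : set V) (T : nat) (g x : nat -> V) : R :=
  \sum_(1 <= t < T.+1) dotv (g t) (x t)
  - inf [set \sum_(1 <= t < T.+1) dotv (g t) y | y in K].

End Defs.

Definition lexlt (s j t i : nat) : bool := (s < t)%N || ((s == t) && (j < i)%N).
Definition lexle (s j t i : nat) : bool := (s < t)%N || ((s == t) && (j <= i)%N).

Definition sub_sigma {dd} {T : measurableType dd} (F : set (set T)) : Prop :=
  sigma_algebra setT F /\ (forall A, F A -> measurable A).

Definition F_measurable {T : Type} {R : realType} (F : set (set T)) (f : T -> R) : Prop :=
  forall B : set R, measurable B -> F (f @^-1` B).

(* Main.v *)
Require Import Defs.
From HB Require Import structures.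
From mathcomp Require Import all_boot all_order all_algebra.
From mathcomp Require Import all_classical all_reals all_analysis.
From mathcomp Require Import measurable_realfun ring lra zify.
Import Order.TTheory GRing.Theory Num.Theory.
Import numFieldNormedType.Exports.
Local Open Scope classical_set_scope.
Local Open Scope ring_scope.

(** Convexity and smoothness give, along each sample path, a Frank-Wolfe
    recursion for the gap [h_i = loss x^i - loss x*]:
      [h_i <= (1 - eta_i) h_(i-1) + eta_i <grad, x_i - x*> + beta eta_i^2 D^2],
    where the gradient is taken at [x^(i-1)]. For [eta_i = 2 / (i + 1)] it
    unrolls to a bound of [h_N] by a weighted average of the linear terms plus
    [4 beta D^2 / (N + 1)]. Since [x_i] is measurable with respect to the past,
    the gradient may be replaced in expectation by its unbiased estimate, and
    the summed linear terms are then dominated by the regrets of the linear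
    optimizers. The choice of [N] turns the error [beta D^2 T / N] into
    [sigma D sqrt T], so that [C = c + 4] works. *)

(** * Euclidean geometry and first-order convexity *)

Section Euclidean.
Set Implicit Arguments. Unset Strict Implicit.
Variables (R : realType) (d : nat).
Implicit Types (u v w x y : 'rV[R]_d) (a : R).

Lemma dotvC u v : dotv u v = dotv v u.
Proof. by apply: eq_bigr => j _; rewrite mulrC. Qed.

Lemma dotvDl u v w : dotv (u + v) w = dotv u w + dotv v w.
Proof. by rewrite -big_split; apply: eq_bigr => j _; rewrite mxE mulrDl. Qed.

Lemma dotvZl a u v : dotv (a *: u) v = a * dotv u v.
Proof. by rewrite mulr_sumr; apply: eq_bigr => j _; rewrite mxE mulrA. Qed.

Lemma dotvZr a u v : dotv u (a *: v) = a * dotv u v.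
Proof. by rewrite dotvC dotvZl dotvC. Qed.

Lemma dotvBl u v w : dotv (u - v) w = dotv u w - dotv v w.
Proof. by rewrite -scaleN1r dotvDl dotvZl mulN1r. Qed.

Lemma dotvBr u v w : dotv u (v - w) = dotv u v - dotv u w.
Proof. by rewrite dotvC dotvBl !(dotvC u). Qed.

Lemma dotv_ge0 u : 0 <= dotv u u.
Proof. by apply: sumr_ge0 => j _; rewrite -expr2 sqr_ge0. Qed.

Lemma enorm_ge0 u : 0 <= enorm u.
Proof. exact: sqrtr_ge0. Qed.

Lemma enormZ a u : enorm (a *: u) = `|a| * enorm u.
Proof.
by rewrite /enorm dotvZl dotvZr mulrA -expr2 sqrtrM ?sqr_ge0 // sqrtr_sqr.
Qed.

Lemma coord_le_enorm u j : `|u 0 j| <= enorm u.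
Proof.
rewrite -sqrtr_sqr ler_wsqrtr // /dotv (bigD1 j) //= -expr2 lerDl.
by apply: sumr_ge0 => k _; rewrite -expr2 sqr_ge0.
Qed.

(** Cauchy-Schwarz: the squared norm of [dotv v v *: u - dotv u v *: v] is [dotv v v] times the
    defect of the squared inequality. A null [v] is split off so that this factor can be
    cancelled. *)
Lemma normr_dotv_le u v : `|dotv u v| <= enorm u * enorm v.
Proof.
rewrite -sqrtrM ?dotv_ge0 // -sqrtr_sqr ler_wsqrtr //.
have [v0|vn0] := eqVneq (dotv v v) 0.
  have vj j : v 0 j = 0.
    apply/eqP; rewrite -normr_eq0 eq_le normr_ge0 andbT.
    by rewrite (le_trans (coord_le_enorm v j)) // /enorm v0 sqrtr0.
  by rewrite v0 mulr0 /dotv big1 ?expr0n // => j _; rewrite vj mulr0.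
have v0 : 0 < dotv v v by rewrite lt_neqAle eq_sym vn0 dotv_ge0.
have := dotv_ge0 (dotv v v *: u - dotv u v *: v).
rewrite dotvBl !dotvBr !dotvZl !dotvZr (dotvC v u) => h.
rewrite -subr_ge0 -(pmulr_rge0 _ v0); apply: le_trans h _.
by rewrite le_eqVlt; apply/orP; left; apply/eqP; ring.
Qed.

Lemma enorm_le_sum u : enorm u <= \sum_(j < d) `|u 0 j|.
Proof.
have s0 : 0 <= \sum_(j < d) `|u 0 j| by apply: sumr_ge0.
rewrite -[leRHS]ger0_norm // -sqrtr_sqr ler_wsqrtr // expr2 mulr_suml.
apply: ler_sum => j _; rewrite (le_trans (ler_norm _)) // normrM.
rewrite ler_wpM2l // (bigD1 j) //= lerDl; exact: sumr_ge0.
Qed.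

Lemma derive_dotv_grad (f : 'rV[R]_d -> R) x v :
  differentiable f x -> 'D_v f x = dotv (grad f x) v.
Proof.
move=> df; rewrite deriveE // [in LHS](row_sum_delta v) linear_sum.
apply: eq_bigr => j _.
by rewrite linearZ /= mxE deriveE // mulrC.
Qed.

(** The derivative along [y - x] is a limit of difference quotients with [0 < h < 1], each at most
    [f y - f x] by convexity. Only the right limit is taken, since the segment is known to lie in
    the domain of convexity for such [h] alone. *)
Lemma convex_first_order (K : set 'rV[R]_d) (f : 'rV[R]_d -> R) x y :
  convex_fun_on K f -> K x -> K y -> differentiable f x ->
  f x + dotv (grad f x) (y - x) <= f y.
Proof.
move=> cf Kx Ky df; rewrite -lerBrDl -derive_dotv_grad // /derive.
have cv := @diff_derivable _ _ _ _ _ (y - x) df.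
rewrite cvg_at_rightE //; apply: limr_le.
  by apply: cvgP; apply: cvg_dnbhs_at_right; exact: cv.
near=> h; have h0 : 0 < h by near: h; exact: nbhs_right_gt.
have h1 : h < 1 by near: h; exact: nbhs_right_lt.
rewrite /= /GRing.scale /= -ler_pdivlMl ?invr_gt0 // invrK.
have := cf y x h Ky Kx; rewrite (ltW h0) (ltW h1) => /(_ isT).
have -> : h *: y + (1 - h) *: x = h *: (y - x) + x.
  by rewrite scalerBl scale1r scalerBr addrA addrAC.
lra.
Unshelve. all: by end_near. Qed.

Lemma convex_set_combination (K : set 'rV[R]_d) x y a :
  convex_set K -> K x -> K y -> 0 <= a <= 1 -> K (a *: x + (1 - a) *: y).
Proof.
move=> cK Kx Ky a01.
have := cK x y (Itv01 (andP a01).1 (andP a01).2).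
rewrite !inE; exact.
Qed.

End Euclidean.

(** * The Frank-Wolfe recursion along one sample path *)

Section FrankWolfe.
Set Implicit Arguments. Unset Strict Implicit.
Variables (R : realType) (d : nat) (K : set 'rV[R]_d) (D beta : R).
Hypothesis convK : convex_set K.
Hypothesis diamK : forall x y, K x -> K y -> enorm (x - y) <= D.
Hypothesis beta0 : 0 <= beta.
Implicit Types (f : 'rV[R]_d -> R) (X : nat -> 'rV[R]_d).

(* The smoothness term needs no Taylor integral: convexity at the new iterate
   bounds [f y - f x] by a gradient at [y], which is then compared with the
   gradient at [x]. This costs [beta] instead of [beta / 2]. *)
Lemma fw_step f x z xs (a : R) :
  convex_fun_on K f -> smooth_on K beta f -> K x -> K z -> K xs -> 0 <= a <= 1 ->
  f ((1 - a) *: x + a *: z) - f xs <=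
  (1 - a) * (f x - f xs) + a * dotv (grad f x) (z - xs) + beta * a ^+ 2 * D ^+ 2.
Proof.
move=> cf [df sf] Kx Kz Kxs a01; have /andP[a0 a1] := a01.
set y := _ *: x + _.
have Ky : K y by rewrite /y addrC; exact: convex_set_combination.
have yx : y - x = a *: (z - x).
  by apply/rowP => j; rewrite !mxE; ring.
have D0 : 0 <= D by rewrite (le_trans (enorm_ge0 (x - x))) ?diamK.
have h1 := convex_first_order cf Ky Kx (df _ Ky).
have h2 := convex_first_order cf Kx Kxs (df _ Kx).
have e1 : dotv (grad f y) (x - y) = - a * dotv (grad f y) (z - x).
  by rewrite -opprB yx -scaleNr dotvZr.
have h3 : dotv (grad f y - grad f x) (z - x) <= beta * a * D ^+ 2.
  rewrite (le_trans (ler_norm _)) // (le_trans (normr_dotv_le _ _)) //.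
  have zx : enorm (z - x) <= D by exact: diamK.
  rewrite expr2 mulrA ler_pM ?enorm_ge0 // (le_trans (sf _ _ Ky Kx)) //.
  by rewrite yx enormZ ger0_norm // mulrA ler_wpM2l // mulr_ge0.
have e2 : dotv (grad f x) (z - xs) =
    dotv (grad f x) (z - x) - dotv (grad f x) (xs - x).
  by rewrite -dotvBr opprB addrA subrK.
have h4 : a * dotv (grad f y - grad f x) (z - x) <= beta * a ^+ 2 * D ^+ 2.
  apply: le_trans (ler_wpM2l a0 h3) _.
  by rewrite le_eqVlt; apply/orP; left; apply/eqP; ring.
rewrite e1 in h1; rewrite dotvBl in h4; rewrite e2.
have h5 : a * (f x + dotv (grad f x) (xs - x)) <= a * f xs by exact: ler_wpM2l.
lra.
Qed.

(** The successor matters: [eta 0] is 2. *)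
Lemma eta_itv01 i : 0 <= Defs.eta R i.+1 <= 1.
Proof.
rewrite /Defs.eta divr_ge0 ?ler0n //= ler_pdivrMr ?ltr0n // mul1r ler_nat; lia.
Qed.

Lemma fw_iter_in X N i : K 0 -> (forall m, (1 <= m <= N)%N -> K (X m)) ->
  (i <= N)%N -> K (fw_iter X i).
Proof.
move=> K0 KX; elim: i => // i IH iN /=.
rewrite addrC; apply: convex_set_combination => //.
- by apply: KX.
- by apply: IH; exact: ltnW.
- exact: eta_itv01.
Qed.

(* With [eta i = 2 / (i + 1)], weighting the gap at step [i] by [i (i + 1)]
   makes the recursion telescope. *)
Lemma fw_gap f X N i xs : convex_fun_on K f -> smooth_on K beta f ->
  K 0 -> (forall m, (1 <= m <= N)%N -> K (X m)) -> K xs -> (i <= N)%N ->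
  (i * i.+1)%:R * (f (fw_iter X i) - f xs) <=
  \sum_(1 <= m < i.+1) (2 * m%:R * dotv (grad f (fw_iter X m.-1)) (X m - xs)
     + 4 * beta * D ^+ 2).
Proof.
move=> cf sf K0 KX Kxs; elim: i => [|i IH] iN.
  (* The weight vanishes at step 0, so the gap at the starting point never enters. *)
  by rewrite mul0n mul0r big_geq.
rewrite big_nat_recr //=; have {IH} := IH (ltnW iN).
set S := \sum_(_ <= _ < _) _.
have Kx : K (fw_iter X i) by exact: (fw_iter_in K0 KX (ltnW iN)).
have := fw_step cf sf Kx (KX i.+1 iN) Kxs (eta_itv01 i).
set x := fw_iter X i; set y := _ *: x + _; set q := dotv _ _.
rewrite /Defs.eta; set p : R := i%:R => h IH.
have p0 : 0 <= p by rewrite ler0n.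
have e1 : (i.+2)%:R = p + 2 by rewrite -addn2 natrD.
have e2 : (i.+1)%:R = p + 1 by rewrite -addn1 natrD.
rewrite !natrM e1 e2 -/p in h IH *.
have pp : 0 < (p + 1) * (p + 2) by rewrite mulr_gt0 //; lra.
apply: le_trans (ler_wpM2l (ltW pp) h) _.
(* Since [1 - 2 / (p + 2) = p / (p + 2)], the old gap receives exactly its own weight [p (p + 1)].
   The smoothness term keeps a factor [(p + 1) / (p + 2)], bounded by 1 below. *)
have -> : (p + 1) * (p + 2) * ((1 - 2 / (p + 2)) * (f x - f xs)
    + 2 / (p + 2) * q + beta * (2 / (p + 2)) ^+ 2 * D ^+ 2) =
  p * (p + 1) * (f x - f xs) + 2 * (p + 1) * q
    + 4 * ((p + 1) / (p + 2)) * (beta * D ^+ 2).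
  by field; rewrite gt_eqF //; lra.
rewrite -addrA lerD // lerD2l -[leRHS]mulrA -[leLHS]mulrA ler_wpM2l //.
rewrite ler_piMl //.
  by rewrite mulr_ge0 // sqr_ge0.
by rewrite ler_pdivrMr; lra.
Qed.

End FrankWolfe.

(** * Integrals of bounded functions and orthogonality *)

Section Integration.
Set Implicit Arguments. Unset Strict Implicit.
Context {dd : measure_display} {Omega : measurableType dd} {R : realType}.
Variable P : probability Omega R.
Implicit Types f g : Omega -> R.

Local Open Scope ereal_scope.
Import HBNNSimple.

(* The integral is a difference of suprema over the simple functions below the
   positive and negative parts, hence monotone on all functions. *)
Lemma integral_monotone (f g : Omega -> \bar R) :
  (forall w, f w <= g w) -> \int[P]_w f w <= \int[P]_w g w.
Proof.
have ge0_mono (h k : Omega -> \bar R) : (forall w, 0 <= h w) ->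
    (forall w, h w <= k w) -> \int[P]_w h w <= \int[P]_w k w.
  move=> h0 hk; have k0 w : 0 <= k w := le_trans (h0 w) (hk w).
  rewrite !ge0_integralTE //.
  apply: ereal_sup_le => _ [s /= sh <-]; exists s => //= w.
  exact: le_trans (sh w) (hk w).
move=> fg; rewrite integralE [leRHS]integralE leeB //; apply: ge0_mono => w //.
- exact: (@funepos_le _ _ setT f g (fun w _ => fg w) w (in_setT w)).
- exact: (@funeneg_le _ _ setT f g (fun w _ => fg w) w (in_setT w)).
Qed.

Local Close Scope ereal_scope.

(** A class closed under ring operations and integrable for a probability, which discharges the
    integrability side conditions. *)
Definition bounded_measurable f :=
  measurable_fun setT f /\ exists M : R, forall w, `|f w| <= M.

Lemma bounded_measurable_integrable (A : set Omega) f :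
  measurable A -> bounded_measurable f -> P.-integrable A (EFin \o f).
Proof.
move=> mA [mf [M fM]]; apply: measurable_bounded_integrable => //.
- by rewrite (le_lt_trans (probability_le1 P mA)) // ltry.
- exact: measurable_funTS.
- by exists M; split=> [|x Mx w _ /=]; rewrite ?num_real // (le_trans (fM w)) // ltW.
Qed.

Lemma bounded_measurable_cst (r : R) : bounded_measurable (fun=> r).
Proof. by split; [exact: measurable_cst | exists `|r|]. Qed.

Lemma bounded_measurableD f g : bounded_measurable f -> bounded_measurable g ->
  bounded_measurable (fun w => f w + g w).
Proof.
move=> [mf [M fM]] [mg [L gL]]; split; first exact: measurable_funD.
by exists (M + L) => w; rewrite (le_trans (ler_normD _ _)) // lerD.
Qed.

Lemma bounded_measurableM f g : bounded_measurable f -> bounded_measurable g ->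
  bounded_measurable (fun w => f w * g w).
Proof.
move=> [mf [M fM]] [mg [L gL]]; split; first exact: measurable_funM.
by exists (M * L) => w; rewrite normrM ler_pM.
Qed.

Lemma bounded_measurableZ (r : R) f : bounded_measurable f ->
  bounded_measurable (fun w => r * f w).
Proof. by apply: bounded_measurableM; exact: bounded_measurable_cst. Qed.

Lemma bounded_measurableB f g : bounded_measurable f -> bounded_measurable g ->
  bounded_measurable (fun w => f w - g w).
Proof.
move=> bf bg; under eq_fun do rewrite -mulN1r.
by apply: bounded_measurableD => //; exact: bounded_measurableZ.
Qed.

Lemma bounded_measurable_sum (I : eqType) (s : seq I) (h : I -> Omega -> R) :
  (forall i, i \in s -> bounded_measurable (h i)) ->
  bounded_measurable (fun w => \sum_(i <- s) h i w).
Proof.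
elim: s => [|i s IH] hs.
  under eq_fun do rewrite big_nil; exact: bounded_measurable_cst.
under eq_fun do rewrite big_cons; apply: bounded_measurableD.
  by apply: hs; rewrite mem_head.
by apply: IH => j js; apply: hs; rewrite inE js orbT.
Qed.

Lemma Rintegral_sum (I : eqType) (s : seq I) (h : I -> Omega -> R) :
  (forall i, i \in s -> bounded_measurable (h i)) ->
  \int[P]_w (\sum_(i <- s) h i w) = \sum_(i <- s) \int[P]_w h i w.
Proof.
elim: s => [|i s IH] hs.
  by under eq_Rintegral do rewrite big_nil; rewrite Rintegral_cst // mul0r big_nil.
under eq_Rintegral do rewrite big_cons.
have hs' j : j \in s -> bounded_measurable (h j).
  by move=> js; apply: hs; rewrite inE js orbT.
rewrite RintegralD ?big_cons ?IH //; apply: bounded_measurable_integrable => //.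
  by apply: hs; rewrite mem_head.
exact: bounded_measurable_sum.
Qed.

Lemma EFin_Rintegral f : bounded_measurable f ->
  (\int[P]_w f w)%:E = (\int[P]_w (f w)%:E)%E.
Proof.
move=> bf; rewrite /Rintegral fineK // integrable_fin_num //.
exact: bounded_measurable_integrable.
Qed.

Lemma Rintegral_prob_cst (r : R) : \int[P]_w r = r.
Proof.
rewrite Rintegral_cst // -[RHS]mulr1; congr (_ * _).
by rewrite -[RHS]/(fine 1%E) -(probability_setT P).
Qed.

(* [Z] is approximated uniformly, up to [1 / n], by a combination of
   indicators of sets in [F]. *)
Lemma Rintegral_orthogonal (F : set (set Omega)) (H Z : Omega -> R) (M : R) :
  (forall A, F A -> measurable A) -> bounded_measurable H ->
  (forall A, F A -> \int[P]_(w in A) H w = 0) ->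
  F_measurable F Z -> (forall w, `|Z w| <= M) ->
  \int[P]_w (H w * Z w) = 0.
Proof.
move=> Fm bH H0 FZ ZM; have [mH [B HB]] := bH.
have bZ : bounded_measurable Z.
  by split; [move=> _ C mC; rewrite setTI; apply/Fm/FZ | exists M].
have bHZ := bounded_measurableM bH bZ.
(* A positive value [I] would contradict the bound at [n = trunc (B / I)]. *)
suff approx (n : nat) : `|\int[P]_w (H w * Z w)| <= B / n.+1%:R.
  apply/eqP; rewrite -normr_eq0 eq_le normr_ge0 andbT leNgt; apply/negP => I0.
  set I := `|_| in approx I0.
  have := truncnS_gt (B / I); set n := Num.trunc _.
  rewrite ltr_pdivrMr // => BnI.
  have := approx n; rewrite ler_pdivlMr ?ltr0n // mulrC => h.
  by have := lt_le_trans BnI h; rewrite ltxx.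
set N : R := n.+1%:R; have N0 : 0 < N by rewrite ltr0n.
(* [q w] numbers the cell of width [1 / N] that contains [Z w], counted from [- M]; [m] exceeds
   every such number. *)
pose q w := Num.trunc (N * (Z w + M)).
have ZM0 w : 0 <= N * (Z w + M).
  by rewrite mulr_ge0 ?(ltW N0) //; have := ZM w; rewrite ler_norml; lra.
pose m := (Num.trunc (N * (M + M))).+1.
have qm w : (q w < m)%N.
  rewrite truncn_lt_nat //; apply: le_lt_trans (truncnS_gt _).
  by rewrite ler_wpM2l ?(ltW N0) // lerD2r; have := ZM w; rewrite ler_norml; lra.
pose A k := q @^-1` [set k].
have FA k : F (A k).
  rewrite (_ : A k = Z @^-1` `[k%:R / N - M, k.+1%:R / N - M[%classic).
    by apply: FZ; exact: measurable_itv.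
  apply/seteqP; split=> w /=; rewrite in_itv /= lerBlDr ltrBrDr;
    rewrite ler_pdivrMr // ltr_pdivlMr // mulrC.
    by move=> <-; exact: truncn_itv.
  by move=> h; exact: truncn_def.
pose Zn w := \sum_(k <- iota 0 m) (k%:R / N - M) * \1_(A k) w.
have bA k : bounded_measurable (\1_(A k) : Omega -> R).
  split; first by apply: measurable_indic; exact: Fm.
  by exists 1 => w; rewrite indicE; case: (_ \in _); rewrite ?normr1 ?normr0.
have bHA k : bounded_measurable (fun w => H w * \1_(A k) w).
  exact: bounded_measurableM.
(* Each term is a multiple of the integral of [H] over some [A k] in [F], which is zero. *)
have HZn : \int[P]_w (H w * Zn w) = 0.
  have -> : \int[P]_w (H w * Zn w) =
      \int[P]_w (\sum_(k <- iota 0 m) (k%:R / N - M) * (H w * \1_(A k) w)).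
    apply: eq_Rintegral => w _; rewrite mulr_sumr.
    by apply: eq_bigr => k _; rewrite mulrCA.
  rewrite Rintegral_sum; last by move=> k _; exact: bounded_measurableZ.
  rewrite big1 // => k _; rewrite RintegralZl //; last exact: bounded_measurable_integrable.
  rewrite -[X in _ * X]/(\int[P]_w (H \* \1_(A k)) w).
  by rewrite -patch_indic -Rintegral_mkcond H0 // mulr0.
have ZnE w : Zn w = (q w)%:R / N - M.
  rewrite /Zn (bigD1_seq (q w)) ?iota_uniq ?mem_iota //=.
  rewrite indicE mem_set // mulr1 big1 ?addr0 // => k kq.
  by rewrite indicE memNset ?mulr0 // /A /= => qk; rewrite qk eqxx in kq.
have bZn : bounded_measurable Zn.
  by apply: bounded_measurable_sum => k _; exact: bounded_measurableZ.
have bHZn := bounded_measurableM bH bZn.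
rewrite -[X in `|X|]subr0 -HZn -RintegralB //; try exact: bounded_measurable_integrable.
have bD := bounded_measurableB bHZ bHZn.
apply: le_trans (le_normr_Rintegral _ _) _ => //.
  exact: bounded_measurable_integrable.
have -> : B / N = \int[P]_w (B / N).
  by rewrite Rintegral_prob_cst.
apply: le_Rintegral => //.
- apply: bounded_measurable_integrable => //; split.
    by apply: measurableT_comp => //; case: bD.
  by case: bD => _ [L hL]; exists L => w; rewrite normr_id.
- apply: bounded_measurable_integrable => //; exact: bounded_measurable_cst.
move=> w _; rewrite -mulrBr normrM ler_pM // ZnE.
have := truncn_itv (ZM0 w); rewrite -/(q w) -natr1 => /andP[h1 h2].
move: h1 h2; set a := (q w)%:R / N.
have -> : (q w)%:R = N * a by rewrite mulrC divfK ?gt_eqF.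
have {1}-> : 1 = N * N^-1 by rewrite divff ?gt_eqF.
rewrite -mulrDr ler_pM2l // ltr_pM2l // => h1 h2.
by move: (N^-1) h1 h2; clearbody a => b h1 h2; rewrite ler_norml; lra.
Qed.

End Integration.

(** * Measurability along random points of [K] *)

Section Composition.
Set Implicit Arguments. Unset Strict Implicit.
Context {dd : measure_display} {Omega : measurableType dd} {R : realType}.
Variable d : nat.

(* [{a < f (Y w)}] is a countable union over the rational cubes whose trace on
   [K] lies in [{a < f}]. *)
Lemma measurable_comp_lipschitz (K : set 'rV[R]_d) (f : 'rV[R]_d -> R) (L : R)
    (Y : Omega -> 'rV[R]_d) : 0 <= L ->
  (forall x y, K x -> K y -> `|f x - f y| <= L * enorm (x - y)) ->
  (forall j, measurable_fun setT (fun w => Y w 0 j)) -> (forall w, K (Y w)) ->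
  measurable_fun setT (fun w => f (Y w)).
Proof.
move=> L0 lf mY KY mT; apply: (measurability _ (RGenOInfty.measurableE R)) => //.
move=> /= _ [_ [a ->] <-]; rewrite setTI preimage_itvoy.
pose cube (pn : {ffun 'I_d -> rat} * nat) (z : 'rV[R]_d) :=
  forall j, `|z 0 j - ratr (pn.1 j)| < pn.2.+1%:R^-1.
pose good pn := forall z, K z -> cube pn z -> a < f z.
rewrite (_ : [set w | _] =
    \bigcup_pn [set w | good pn /\ cube pn (Y w)]); last first.
  apply/seteqP; split=> [w /= aw|w [pn _ [/= gpn cw]]]; last exact: gpn.
  (* A point of a cube of half-side below [b] containing [Y w] is within [2 b] of it in each
     coordinate, hence within [2 d b] in norm. So [f] drops by at most [2 L d b], less than
     [f (Y w) - a]. *)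
  pose b := (f (Y w) - a) / (L * d%:R * 2 + 1).
  have c0 : 0 < L * d%:R * 2 + 1.
    by rewrite ltr_wpDl // !mulr_ge0.
  have b0 : 0 < b by rewrite divr_gt0 // subr_gt0.
  pose n := Num.trunc b^-1.
  have nb : n.+1%:R^-1 < b.
    by rewrite invf_plt ?posrE ?ltr0n //; exact: truncnS_gt.
  have r0 : 0 < (n.+1%:R^-1 : R) by rewrite invr_gt0 ltr0n.
  have /choice[p pY] : forall j : 'I_d,
      exists q : rat, `|Y w 0 j - ratr q| < n.+1%:R^-1.
    move=> j; have : Y w 0 j - n.+1%:R^-1 < Y w 0 j + n.+1%:R^-1.
      by move: r0; move: (n.+1%:R^-1 : R) => r; lra.
    by move=> /rat_in_itvoo[q]; rewrite in_itv /= => h; exists q; rewrite ltr_distlC.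
  have cw : cube ([ffun j => p j], n) (Y w) by move=> j; rewrite /= ffunE.
  exists ([ffun j => p j], n) => //; split => // z Kz cz.
  have zY : enorm (z - Y w) <= d%:R * 2 * b.
    apply: le_trans (enorm_le_sum _) _.
    have -> : d%:R * 2 * b = \sum_(j < d) 2 * b.
      by rewrite sumr_const card_ord -mulrA mulr_natl.
    apply: ler_sum => j _; rewrite !mxE.
    have := cz j; have := cw j; rewrite /= ffunE !ltr_norml ler_norml.
    move: nb; clearbody b; move: (n.+1%:R^-1 : R) (ratr (p j) : R) => r s; lra.
  have := lf _ _ Kz (KY w); rewrite ler_norml => /andP[h _].
  have h2 := ler_wpM2l L0 zY.
  have bE : b * (L * d%:R * 2 + 1) = f (Y w) - a by rewrite divfK // gt_eqF.
  by nra.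
apply: countable_bigcupT_measurable => // pn.
(* [good pn] does not depend on [w]: the set is empty or cut out by finitely many coordinate
   conditions. *)
have [gpn|ngpn] := pselect (good pn); last first.
  by rewrite (_ : [set w | _] = set0) //; apply/seteqP; split => // w [].
rewrite (_ : [set w | _] =
    \bigcap_(j in [set: 'I_d]) [set w | `|Y w 0 j - ratr (pn.1 j)| < pn.2.+1%:R^-1]).
  apply: fin_bigcap_measurable => // j _.
  rewrite -[X in measurable X]setTI.
  have := @measurable_fun_ltr _ _ _ setT (fun w => `|Y w 0 j - ratr (pn.1 j)|)
    (fun=> pn.2.+1%:R^-1).
  apply => //; apply: measurableT_comp => //; exact: measurable_funB.
apply/seteqP; split=> [w [_ h] j _|w h]; first exact: h.
by split => // j; exact: h.
Qed.

Lemma measurable_fw_iter (X : nat -> Omega -> 'rV[R]_d) i :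
  (forall m j, measurable_fun setT (fun w => X m w 0 j)) ->
  forall j, measurable_fun setT (fun w => fw_iter (fun m => X m w) i 0 j).
Proof.
move=> mX; elim: i => [|i IH] j /=.
  by under eq_fun do rewrite mxE; exact: measurable_cst.
under eq_fun do rewrite !mxE.
by apply: measurable_funD; apply: measurable_funM => //; exact: measurable_cst.
Qed.

End Composition.

(** Comparing [inf] with the value at [xs] requires a lower bound on the set; Cauchy-Schwarz
    supplies [- sigma * D] per round. *)
Lemma olo_regret_ge (R : realType) (d : nat) (K : set 'rV[R]_d) (D sigma : R)
    (T : nat) (g x : nat -> 'rV[R]_d) (xs : 'rV[R]_d) :
  (forall y, K y -> enorm y <= D) ->
  (forall t, (1 <= t <= T)%N -> enorm (g t) <= sigma) -> K xs ->
  \sum_(1 <= t < T.+1) dotv (g t) (x t - xs) <= olo_regret K T g x.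
Proof.
move=> KD gs Kxs.
under eq_bigr do rewrite dotvBr; rewrite sumrB lerD2l lerN2.
apply: ge_inf; last by exists xs.
exists (\sum_(1 <= t < T.+1) - (sigma * D)) => _ [y Ky <-].
apply: ler_sum_nat => t tT; rewrite lerNl.
rewrite (le_trans (ler_norm _)) // normrN (le_trans (normr_dotv_le _ _)) //.
by rewrite ler_pM ?enorm_ge0 ?gs ?KD.
Qed.

(** * Exchanging gradients and their unbiased estimates *)

Section Unbiased.
Set Implicit Arguments. Unset Strict Implicit.
Context {dd : measure_display} {Omega : measurableType dd} {R : realType}.
Variables (P : probability Omega R) (d : nat).

Definition bounded_measurable_vec (Y : Omega -> 'rV[R]_d) :=
  forall j, bounded_measurable (fun w => Y w 0 j).

Lemma bounded_measurable_dotv (Y Z : Omega -> 'rV[R]_d) :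
  bounded_measurable_vec Y -> bounded_measurable_vec Z ->
  bounded_measurable (fun w => dotv (Y w) (Z w)).
Proof.
by move=> bY bZ; apply: bounded_measurable_sum => j _; exact: bounded_measurableM.
Qed.

Lemma bounded_measurable_vecB (Y Z : Omega -> 'rV[R]_d) :
  bounded_measurable_vec Y -> bounded_measurable_vec Z ->
  bounded_measurable_vec (fun w => Y w - Z w).
Proof.
move=> bY bZ j; under eq_fun do rewrite !mxE; exact: bounded_measurableB.
Qed.

(** Coordinatewise, [G - g] has zero integral over every set of [F], so it is orthogonal to the
    [F]-measurable [X]. *)
Lemma Rintegral_dotv_unbiased (F : set (set Omega)) (G g X : Omega -> 'rV[R]_d)
    (xs : 'rV[R]_d) :
  sub_sigma F -> bounded_measurable_vec G -> bounded_measurable_vec g ->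
  bounded_measurable_vec X -> (forall j, F_measurable F (fun w => X w 0 j)) ->
  (forall k A, F A -> (\int[P]_(w in A) (G w 0 k)%:E =
                       \int[P]_(w in A) (g w 0 k)%:E)%E) ->
  \int[P]_w dotv (g w) (X w - xs) = \int[P]_w dotv (G w) (X w - xs).
Proof.
move=> [sF mF] bG bg bX FX Gg.
(* Taking the whole space as the set of [F] removes the constant [xs]. *)
have FT : F setT.
  by have [F0 FD _] := sF; have := FD _ F0; rewrite setD0.
have bxs : bounded_measurable_vec (fun=> xs).
  by move=> j; exact: bounded_measurable_cst.
have bXxs := bounded_measurable_vecB bX bxs.
have int f : bounded_measurable f -> P.-integrable setT (EFin \o f).
  exact: bounded_measurable_integrable.
apply/esym/eqP; rewrite -subr_eq0 -RintegralB //;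
  try by apply: int; exact: bounded_measurable_dotv.
apply/eqP; under eq_Rintegral do rewrite -dotvBl.
have bH := bounded_measurable_vecB bG bg.
rewrite Rintegral_sum; last first.
  by move=> k _; apply: bounded_measurableM.
rewrite big1 // => k _.
have H0 A : F A -> \int[P]_(w in A) (G w - g w) 0 k = 0.
  move=> FA; have mA := mF _ FA.
  under eq_Rintegral do rewrite !mxE.
  rewrite RintegralB //; try exact: bounded_measurable_integrable.
  by rewrite /Rintegral Gg // subrr.
have -> : \int[P]_w ((G w - g w) 0 k * (X w - xs) 0 k) =
    \int[P]_w ((G w - g w) 0 k * X w 0 k - (G w - g w) 0 k * xs 0 k).
  by apply: eq_Rintegral => w _; rewrite -mulrBr; congr (_ * _); rewrite !mxE.
rewrite RintegralB //; try by apply: int; apply: bounded_measurableM => //;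
  exact: bxs.
rewrite RintegralZr //; last exact: int.
have [_ [M XM]] := bX k.
by rewrite (Rintegral_orthogonal mF (bH k) H0 (FX k) XM) H0 // mul0r subrr.
Qed.

End Unbiased.

(** * Summation over rounds and optimizers *)

Theorem theorem1 (R : realType) (c : R) :
  exists C : R,
  forall (d : nat) (K : set 'rV[R]_d) (D beta sigma : R) (T N : nat)
    (loss : nat -> 'rV[R]_d -> R)
    (dO : measure_display) (Omega : measurableType dO) (P : probability Omega R)
    (F : nat -> nat -> set (set Omega))
    (X G : nat -> nat -> Omega -> 'rV[R]_d)
    (xstar : 'rV[R]_d),
  (* the domain: compact convex set of diameter D (containing the start point 0) *)
  compact K -> convex_set K -> K 0 ->
  (forall x y, K x -> K y -> enorm (x - y) <= D) ->
  (* the losses: convex and beta-smooth on K *)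
  (forall t, (1 <= t <= T)%N -> convex_fun_on K (loss t) /\ smooth_on K beta (loss t)) ->
  (* parameters: N = beta D sqrt(T) / sigma, a positive integer *)
  0 < sigma -> (0 < N)%N -> N%:R = beta * D * Num.sqrt T%:R / sigma ->
  (* F is a filtration indexed lexicographically by the oracle calls (t, i) *)
  (forall t i, sub_sigma (F t i)) ->
  (forall s j t i, lexle s j t i -> F s j `<=` F t i) ->
  (* OLO outputs x_{t,i} lie in K and are determined by the information before call (t,i) *)
  (forall t i, (1 <= t <= T)%N -> (1 <= i <= N)%N ->
     forall w, K (X t i w)) ->
  (forall t i (j : 'I_d), F_measurable (F t i) (fun w => X t i w 0 j)) ->
  (* oracle answers g_{t,i}: adapted, bounded by sigma, and conditionally unbiased
     for the gradient at the query point x_t^{i-1} *)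
  (forall s j t i (k : 'I_d), lexlt s j t i -> F_measurable (F t i) (fun w => G s j w 0 k)) ->
  (forall t i w, (1 <= t <= T)%N -> (1 <= i <= N)%N -> enorm (G t i w) <= sigma) ->
  (forall t i (k : 'I_d) (A : set Omega), (1 <= t <= T)%N -> (1 <= i <= N)%N -> F t i A ->
     (\int[P]_(w in A) (G t i w 0 k)%:E =
      \int[P]_(w in A) (grad (loss t) (fw_iter (fun m => X t m w) i.-1) 0 k)%:E)%E) ->
  (* each OLO A_i has expected regret at most c sigma D sqrt(T) on its losses *)
  (forall i, (1 <= i <= N)%N ->
     (\int[P]_w (olo_regret K T (fun t => G t i w) (fun t => X t i w))%:E
        <= (c * sigma * D * Num.sqrt T%:R)%:E)%E) ->
  K xstar ->
  (\int[P]_w (\sum_(1 <= t < T.+1)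
                (loss t (fw_iter (fun m => X t m w) N) - loss t xstar))%:E
     <= (C * sigma * D * Num.sqrt T%:R)%:E)%E.
Proof.
exists (c + 4) => d K D beta sigma T N loss dO Omega P F X G xstar.
move=> _ convK K0 diamK hloss s0 N0 NE sF Fmono KX FX FG Gs unb regret Kxs.
have D0 : 0 <= D by rewrite (le_trans (enorm_ge0 (0 - 0 : 'rV[R]_d))) ?diamK.
have KD y : K y -> enorm y <= D by move=> Ky; rewrite -[y]subr0 diamK.
(* A negative [beta] would make the prescribed value of [N] nonpositive. *)
have beta0 : 0 <= beta.
  have : 0 < N%:R :> R by rewrite ltr0n.
  rewrite NE pmulr_lgt0 ?invr_gt0 // -mulrA => bD.
  rewrite leNgt; apply/negP => b0; move: bD; apply/negP; rewrite -leNgt.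
  by rewrite mulr_le0_ge0 ?(ltW b0) // mulr_ge0.
pose xi t i w := fw_iter (fun m => X t m w) i.
pose g t i w := grad (loss t) (xi t i.-1 w).
have mX t i j : measurable_fun setT (fun w => X t i w 0 j).
  by move=> _ B mB; rewrite setTI; have [_] := sF t i; apply; exact: FX.
have mG t i j : measurable_fun setT (fun w => G t i w 0 j).
  (* The answer to call [(t, i)] is known by the next index [(t, i.+1)]. *)
  move=> _ B mB; rewrite setTI; have [_] := sF t i.+1; apply.
  by apply: FG => //; rewrite /lexlt eqxx ltnSn orbT.
have Kxi t i w : (1 <= t <= T)%N -> (i <= N)%N -> K (xi t i w).
  by move=> tT iN; apply: fw_iter_in iN => // m mN; exact: KX.
have bX t i : (1 <= t <= T)%N -> (1 <= i <= N)%N ->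
    bounded_measurable_vec (X t i).
  move=> tT iN j; split=> //; exists D => w.
  by rewrite (le_trans (coord_le_enorm _ _)) // KD //; exact: KX.
have bG t i : (1 <= t <= T)%N -> (1 <= i <= N)%N ->
    bounded_measurable_vec (G t i).
  move=> tT iN j; split=> //; exists sigma => w.
  by rewrite (le_trans (coord_le_enorm _ _)) // Gs.
(* Gradient coordinates are [beta]-Lipschitz on [K]. This gives measurability along the iterates,
   and boundedness by comparison with the point 0. *)
have bg t i : (1 <= t <= T)%N -> (1 <= i <= N)%N ->
    bounded_measurable_vec (g t i).
  move=> tT iN k; have [_ [_ lip]] := hloss t tT.
  have lipk x y : K x -> K y ->
      `|grad (loss t) x 0 k - grad (loss t) y 0 k| <= beta * enorm (x - y).
    move=> Kx Ky; apply: le_trans (lip _ _ Kx Ky).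
    by apply: le_trans (coord_le_enorm _ k); rewrite !mxE.
  have iN1 : (i.-1 <= N)%N by lia.
  split.
    apply: (measurable_comp_lipschitz beta0 lipk) => [j|w]; last exact: Kxi.
    exact: measurable_fw_iter.
  exists (`|grad (loss t) 0 0 k| + beta * D) => w.
  rewrite -[X in `|X|](subrK (grad (loss t) 0 0 k)) addrC.
  rewrite (le_trans (ler_normD _ _)) // lerD2l.
  apply: le_trans (lipk _ _ (Kxi _ _ w tT iN1) K0) _.
  by rewrite ler_wpM2l // diamK //; exact: Kxi.
have bxs : bounded_measurable_vec (fun _ : Omega => xstar).
  by move=> j; exact: bounded_measurable_cst.
(* The field [g'] is a parameter: it stands for the true gradients [g] and for the oracle answers
   [G]. *)
pose S (g' : nat -> nat -> Omega -> 'rV[R]_d) i w :=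
  \sum_(1 <= t < T.+1) dotv (g' t i w) (X t i w - xstar).
have bterm g' t i : bounded_measurable_vec (g' t i) ->
    (1 <= t <= T)%N -> (1 <= i <= N)%N ->
    bounded_measurable (fun w => dotv (g' t i w) (X t i w - xstar)).
  move=> bg' tT iN; apply: bounded_measurable_dotv => //.
  by apply: bounded_measurable_vecB => //; exact: bX.
have bS g' i : (forall t, (1 <= t <= T)%N -> bounded_measurable_vec (g' t i)) ->
    (1 <= i <= N)%N -> bounded_measurable (S g' i).
  move=> bg' iN; apply: bounded_measurable_sum => t.
  by rewrite mem_index_iota ltnS => tT; apply: bterm => //; exact: bg'.
have intS g' i : (forall t, (1 <= t <= T)%N -> bounded_measurable_vec (g' t i)) ->
    (1 <= i <= N)%N -> \int[P]_w S g' i w =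
    \sum_(1 <= t < T.+1) \int[P]_w dotv (g' t i w) (X t i w - xstar).
  move=> bg' iN; apply: Rintegral_sum => t.
  by rewrite mem_index_iota ltnS => tT; apply: bterm => //; exact: bg'.
pose Q := sigma * D * Num.sqrt T%:R.
have ES i : (1 <= i <= N)%N -> \int[P]_w S g i w <= c * Q.
  move=> iN; have -> : \int[P]_w S g i w = \int[P]_w S G i w.
    rewrite !intS // => [|t tT|t tT]; [|exact: bG|exact: bg].
    apply: eq_big_nat => t; rewrite ltnS => tT.
    apply: (Rintegral_dotv_unbiased _ (sF t i)) => //.
    - exact: bG.
    - exact: bg.
    - exact: bX.
    - by move=> k A FA; exact: unb.
  rewrite -lee_fin EFin_Rintegral; last by apply: bS => // t tT; exact: bG.
  apply: le_trans (_ : (_ <= (c * sigma * D * Num.sqrt T%:R)%:E)%E) _; last first.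
    by rewrite lee_fin /Q !mulrA.
  (* Monotonicity for arbitrary functions avoids proving that the regret, an infimum over [K], is
     measurable. *)
  apply: le_trans (regret i iN); apply: integral_monotone => w; rewrite lee_fin.
  by apply: (@olo_regret_ge _ _ _ D sigma) => // t tT; exact: Gs.
(* [M] is the weight of the final gap in [fw_gap]; [U] is the resulting pathwise bound, summed over
   rounds. *)
pose M : R := (N * N.+1)%:R.
have M0 : 0 < M by rewrite ltr0n muln_gt0 N0.
pose U w := M^-1 * (\sum_(1 <= i < N.+1) 2 * i%:R * S g i w +
  4 * beta * D ^+ 2 * N%:R * T%:R).
have bSum : bounded_measurable (fun w => \sum_(1 <= i < N.+1) 2 * i%:R * S g i w).
  apply: bounded_measurable_sum => i; rewrite mem_index_iota ltnS => iN.
  by apply: bounded_measurableZ; apply: bS => // t tT; exact: bg.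
have bU : bounded_measurable U.
  apply: bounded_measurableZ; apply: bounded_measurableD => //.
  exact: bounded_measurable_cst.
apply: (@le_trans _ _ (\int[P]_w (U w)%:E)%E).
  apply: integral_monotone => w; rewrite lee_fin /U mulrC ler_pdivlMr // mulrC mulr_sumr.
  have -> : \sum_(1 <= i < N.+1) 2 * i%:R * S g i w + 4 * beta * D ^+ 2 * N%:R * T%:R =
      \sum_(1 <= t < T.+1) \sum_(1 <= i < N.+1)
        (2 * i%:R * dotv (g t i w) (X t i w - xstar) + 4 * beta * D ^+ 2).
    under [RHS]eq_bigr do rewrite big_split /= sumr_const_nat subn1 /=.
    rewrite big_split /= sumr_const_nat subn1 /= !mulr_natr exchange_big /=.
    by congr (_ + _); apply: eq_bigr => i _; rewrite mulr_sumr.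
  apply: ler_sum_nat => t; rewrite ltnS => tT; have [cl sl] := hloss t tT.
  by apply: (fw_gap convK diamK beta0 cl sl K0 _ Kxs (leqnn N)) => m mN; exact: KX.
rewrite -EFin_Rintegral // lee_fin RintegralZl //; last first.
  apply: bounded_measurable_integrable => //; apply: bounded_measurableD => //.
  exact: bounded_measurable_cst.
rewrite RintegralD //; try by apply: bounded_measurable_integrable => //;
  exact: bounded_measurable_cst.
rewrite Rintegral_prob_cst Rintegral_sum; last first.
  move=> i; rewrite mem_index_iota ltnS => iN.
  by apply: bounded_measurableZ; apply: bS => // t tT; exact: bg.
have hsum : \sum_(1 <= i < N.+1) \int[P]_w (2 * i%:R * S g i w) <= M * (c * Q).
  apply: le_trans (_ : _ <= \sum_(1 <= i < N.+1) 2 * i%:R * (c * Q)) _.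
    apply: ler_sum_nat => i; rewrite ltnS => iN.
    rewrite RintegralZl // ?ler_wpM2l ?ES ?mulr_ge0 //.
    by apply: bounded_measurable_integrable => //; apply: bS => // t tT; exact: bg.
  rewrite -mulr_suml -mulr_sumr le_eqVlt; apply/orP; left; apply/eqP; congr (_ * _).
  (* The weights [2 i] sum to [M], so the regret bounds are genuinely averaged. *)
  rewrite /M; elim: (N) => [|n IH]; first by rewrite big_geq ?mulr0 ?mul0n.
  by rewrite big_nat_recr //= mulrDr IH -natrM -natrD; congr (_%:R); lia.
have sqT : Num.sqrt T%:R ^+ 2 = T%:R :> R by rewrite sqr_sqrtr.
have NQ : N%:R * Q = beta * D ^+ 2 * T%:R.
  by move: sqT NE; rewrite /Q; set r := Num.sqrt _ => <- ->; field; rewrite gt_eqF.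
have Q0 : 0 <= Q by rewrite !mulr_ge0 // ltW.
have -> : (c + 4) * sigma * D * Num.sqrt T%:R = M^-1 * (M * (c * Q) + M * (4 * Q)).
  by rewrite -mulrDr mulKf ?gt_eqF // -mulrDl /Q !mulrA.
rewrite ler_pM2l ?invr_gt0 // lerD //.
(* The choice of [N] turns the smoothness error into [4 N^2 Q], and [N^2] is at most [M]. *)
have -> : 4 * beta * D ^+ 2 * N%:R * T%:R = N%:R * N%:R * (4 * Q).
  by transitivity (4 * N%:R * (N%:R * Q)); [rewrite NQ | clearbody Q]; ring.
by rewrite ler_wpM2r ?(mulr_ge0 _ Q0) // -natrM ler_nat leq_mul.
Qed.
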